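(* Let $d\ge 1$. The number $f_{\ge d-2}(d)$ of partitions of the $d$-dimensional cube into disjoint faces of dimension at least $d-2$ is $$f_{\ge d-2}(d)=1-\binom{d}{2}+d^3.$$
   Context: A partition of the $d$-dimensional cube into disjoint faces means a set partition of the vertex set $\{0,1\}^d$ into blocks each of which is the vertex set of a (nonempty) face of the cube $[0,1]^d$. Such a face is obtained by fixing the values of the coordinates in some $S\subseteq\{1,\dots,d\}$ to be $0$ or $1$ and letting the remaining coordinates vary freely. It has dimension $d-|S|$. The number $f_{\ge m}(d)$ counts such partitions in which every face used has dimension at least $m$. *)

(* Defs.v *)
From mathcomp Require Import all_boot all_order all_algebra.
Set Implicit Arguments.
Unset Strict Implicit.
Unset Printing Implicit Defensive.

Definition cube (d : nat) : finType := {ffun 'I_d -> bool}.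

(* Only the values of [a] on [S] matter. *)
Definition face (d : nat) (S : {set 'I_d}) (a : cube d) : {set cube d} :=
  [set x : cube d | [forall i in S, x i == a i]].

(* The set [S] of fixed coordinates is determined by the face, so the dimension
   [d - #|S|] does not depend on the presentation of [B] chosen here. *)
Definition face_of_dim (d k : nat) (B : {set cube d}) : bool :=
  [exists S : {set 'I_d}, exists a : cube d,
    (B == face S a) && (d - #|S| == k)].

Definition face_dim_ge (d m : nat) (B : {set cube d}) : bool :=
  [exists k : 'I_d.+1, (m <= k) && face_of_dim k B].

Definition face_partitions_ge (m d : nat) : {set {set {set cube d}}} :=
  [set P : {set {set cube d}} |
    partition P [set: cube d] && [forall B in P, face_dim_ge m B]].

Definition f_ge (m d : nat) : nat := #|face_partitions_ge m d|.

(* Main.v *)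
(** Call a coordinate [v] sensitive at [x] if flipping it moves [x] out of its
    block.  The block of [x] is the face through [x] fixing the sensitive
    coordinates, and two points in distinct blocks differ at a coordinate
    sensitive at both.  With at most two sensitive coordinates everywhere, this
    forces a nontrivial partition to have a coordinate [i] sensitive at every
    point, and then each half [x i = b] is either a block or is cut once more
    along some coordinate.  So every nontrivial partition comes from a triple
    [(i, j, k)]: cut along [i], then cut the two halves along [j] and [k], where
    cutting along [i] again means leaving the half whole.  The only coincidences
    among the [d ^ 3] triples are [(i, j, j)] and [(j, i, i)]. *)
Require Import Defs.
From mathcomp Require Import all_boot all_order all_algebra.
From mathcomp Require Import zify ring.
Set Implicit Arguments.
Unset Strict Implicit.
Unset Printing Implicit Defensive.

(** * Faces and coordinate flips *)

Section Faces.

Variable d : nat.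
Implicit Types (x y z w a : cube d) (S : {set 'I_d}) (u v i j k : 'I_d).

Definition flip v x : cube d := [ffun u => x u (+) (u == v)].

Lemma faceP S a x : reflect {in S, x =1 a} (x \in face S a).
Proof.
rewrite inE; apply: (iffP forall_inP) => H v /H; first by move/eqP.
by move=> ->.
Qed.

Lemma face_recenter S a x : x \in face S a -> face S a = face S x.
Proof.
move=> /faceP Hx; apply/setP => y.
by apply/faceP/faceP => H v Hv; rewrite H // Hx.
Qed.

Lemma flip_face S a x v :
  x \in face S a -> (flip v x \in face S a) = (v \notin S).
Proof.
move=> /face_recenter ->; apply/faceP/idP => [H|Hv u Hu].
  by apply/negP => /H; rewrite ffunE eqxx addbT; case: (x v).
by rewrite ffunE; case: eqP Hu Hv => [-> -> //|]; rewrite addbF.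
Qed.

Lemma face_dim_geP (B : {set cube d}) :
  reflect (exists S a, #|S| <= 2 /\ B = face S a) (face_dim_ge (d - 2) B).
Proof.
apply: (iffP existsP) => [[k /andP[lek /existsP[S /existsP[a]]]]|[S [a [leS ->]]]].
  case/andP=> /eqP -> /eqP eqk; exists S, a; split=> //.
  (* When [d <= 2] the inequality between dimensions is void, and the bound 2 comes from [#|S| <= d]
     alone. *)
  have leSd : #|S| <= d by rewrite -[leqRHS]card_ord max_card.
  by move: lek leSd; rewrite -eqk; move: #|S| => n; lia.
have ltk : d - #|S| < d.+1 by rewrite ltnS leq_subr.
exists (Ordinal ltk); rewrite /= leq_sub2l //=.
by apply/existsP; exists S; apply/existsP; exists a; rewrite !eqxx.
Qed.

(** * Sensitive coordinates of a partition *)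

Definition sens (P : {set {set cube d}}) x : {set 'I_d} :=
  [set v | flip v x \notin pblock P x].

Section FacePartition.

Variable P : {set {set cube d}}.
Hypothesis HP : P \in face_partitions_ge (d - 2) d.

Let partP : partition P [set: cube d].
Proof. by move: HP; rewrite inE => /andP[]. Qed.

Let trivP : trivIset P.
Proof. by case/and3P: partP. Qed.

Let mem_block x : x \in pblock P x.
Proof. by rewrite mem_pblock (cover_partition partP). Qed.

(** Flipping a coordinate leaves a face exactly when the face fixes it, so [sens] recovers the fixed
    coordinates of the block. *)
Lemma sens_spec x : #|sens P x| <= 2 /\ pblock P x = face (sens P x) x.
Proof.
move: HP; rewrite inE => /andP[_ /forall_inP/(_ (pblock P x))].
rewrite pblock_mem ?(cover_partition partP) // => /(_ isT)/face_dim_geP.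
case=> S [a [leS eqB]]; have xB := mem_block x.
suff -> : sens P x = S by rewrite eqB in xB *; rewrite (face_recenter xB).
by apply/setP=> v; rewrite inE eqB flip_face -?eqB // negbK.
Qed.

Lemma sens_same x y : y \in pblock P x -> sens P y = sens P x.
Proof.
move=> yB; have [_ eqx] := sens_spec x.
apply/setP=> v; rewrite inE.
rewrite (same_pblock trivP yB) eqx flip_face ?negbK //.
by rewrite -eqx.
Qed.

(** Otherwise the point [z], copied from [x] on [sens P x] and from [y] elsewhere, would lie in both
    blocks. *)
Lemma sens_separate x y : y \notin pblock P x ->
  exists v, [/\ v \in sens P x, v \in sens P y & x v != y v].
Proof.
move=> yx.
have [/existsP[v /and3P[*]]|] :=
  boolP [exists v, [&& v \in sens P x, v \in sens P y & x v != y v]].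
  by exists v.
rewrite negb_exists => /forallP noV; case/negP: yx.
pose z : cube d := [ffun v => if v \in sens P x then x v else y v].
have zx : z \in pblock P x.
  by have [_ ->] := sens_spec x; apply/faceP=> v vx; rewrite ffunE vx.
have zy : z \in pblock P y.
  have [_ ->] := sens_spec y; apply/faceP=> v vy; rewrite ffunE.
  by case: ifP => // vx; move: (noV v); rewrite vx vy /= negbK => /eqP.
by rewrite -(same_pblock trivP zx) (same_pblock trivP zy).
Qed.

Lemma sens_flip_into w x v :
  w \notin pblock P x -> flip v w \in pblock P x -> v \in sens P w.
Proof.
move=> wx fx; rewrite inE; apply: contra wx => fw.
by rewrite -(same_pblock trivP fx) (same_pblock trivP fw).
Qed.

Lemma sens_eq2 x i j : i \in sens P x -> j \in sens P x -> i != j ->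
  sens P x = [set i; j].
Proof.
move=> ix jx ij; have [le2 _] := sens_spec x.
by apply/eqP; rewrite eq_sym eqEcard subUset !sub1set ix jx cards2 ij.
Qed.

(** The sets [sens P x] have at most two elements and pairwise meet by [sens_separate]. Without a
    common element they include a triangle [ij], [jk], [ik], which forces a point with three
    sensitive coordinates. *)
Lemma common_sens : (forall x, sens P x != set0) ->
  exists i, forall x, i \in sens P x.
Proof.
move=> sens_n0; pose x : cube d := [ffun=> false].
suff /existsP[i /forallP iS] : [exists i, [forall x, i \in sens P x]].
  by exists i.
apply: contraT; rewrite negb_exists => /forallP noC.
have avoid i : exists y, i \notin sens P y.
  by have := noC i; rewrite negb_forall => /existsP.
have sep y z v : v \in sens P y -> v \notin sens P z -> z \notin pblock P y.
  by move=> vy; apply: contra => /sens_same ->.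
have /set0Pn[i ix] := sens_n0 x.
have [y iy] := avoid i.
have [j [jx jy xyj]] := sens_separate (sep _ _ _ ix iy).
have [z jz] := avoid j.
have ij : i != j by apply: contraNneq iy => ->.
have Sx := sens_eq2 ix jx ij.
have [i' [i'x iz xzi]] := sens_separate (sep _ _ _ jx jz).
have ei : i' = i.
  by move: i'x; rewrite Sx => /set2P[] // ei; rewrite -ei iz in jz.
subst i'.
have [k [kz ky zyk]] := sens_separate (sep _ _ _ iz iy).
have ik : i != k by apply: contraNneq iy => ->.
have jk : j != k by apply: contraNneq jz => ->.
have Sy := sens_eq2 jy ky jk; have Sz := sens_eq2 iz kz ik.
(* The blocks of [x], [y], [z] fix [ij], [jk], [ik]; the point [w] avoids all
   three, but each of its neighbours along [i], [j], [k] lies in one of them. *)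
pose w : cube d := [ffun v => if v == i then x i else
                              if v == j then y j else z k].
have wi : w i = x i by rewrite ffunE eqxx.
have wj : w j = y j by rewrite ffunE eq_sym (negPf ij) eqxx.
have wk : w k = z k by rewrite ffunE eq_sym (negPf ik) eq_sym (negPf jk).
have blockP a (b : cube d) : reflect {in sens P a, b =1 a} (b \in pblock P a).
  by have [_ ->] := sens_spec a; apply: faceP.
have iw : i \in sens P w.
  apply: (@sens_flip_into w z).
    by apply: contra xzi => /blockP/(_ _ iz); rewrite wi => ->.
  apply/blockP=> v; rewrite Sz ffunE => /set2P[] ->.
    by rewrite wi eqxx; case: (x i) (z i) xzi => [] [].
  by rewrite wk eq_sym (negPf ik) addbF.
have jw : j \in sens P w.
  apply: (@sens_flip_into w x).
    by apply: contra xyj => /blockP/(_ _ jx); rewrite wj => ->.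
  apply/blockP=> v; rewrite Sx ffunE => /set2P[] ->.
    by rewrite wi (negPf ij) addbF.
  by rewrite wj eqxx; case: (x j) (y j) xyj => [] [].
have kw : k \in sens P w.
  apply: (@sens_flip_into w y).
    by apply: contra zyk => /blockP/(_ _ ky); rewrite wk => ->.
  apply/blockP=> v; rewrite Sy ffunE => /set2P[] ->.
    by rewrite wj (negPf jk) addbF.
  by rewrite wk eqxx; case: (z k) (y k) zyk => [] [].
move: kw; rewrite (sens_eq2 iw jw ij) => /set2P[] e.
  by rewrite e eqxx in ik.
by rewrite e eqxx in jk.
Qed.

(** Distinct blocks in the same half are separated by a common sensitive coordinate other than [i],
    hence by the second coordinate [j] of one fixed block. If that block has no second coordinate,
    it fills the half, and [j = i]. *)
Lemma sens_half i b : (forall x, i \in sens P x) ->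
  exists j, forall x, x i = b -> sens P x = [set i; j].
Proof.
move=> iS; pose x : cube d := [ffun=> b].
have [j Sx] : exists j, sens P x = [set i; j].
  have [/eqP|[j]] := set_0Vmem (sens P x :\ i).
    rewrite setD_eq0 => Sx; exists i; apply/eqP.
    by rewrite setUid eqEsubset Sx sub1set iS.
  rewrite in_setD1 eq_sym => /andP[ij jS]; exists j; exact: sens_eq2.
exists j => y yi; have [yx|/sens_separate] := boolP (y \in pblock P x).
  by rewrite (sens_same yx).
case=> v [vx vy neq]; have vi : v != i.
  by apply: contraNneq neq => ->; rewrite yi ffunE.
move: vx; rewrite Sx !inE (negPf vi) /= => /eqP vj; subst v.
by apply: sens_eq2; rewrite // eq_sym.
Qed.

End FacePartition.

(** * Partitions obtained from triples *)

Definition cut (t : 'I_d * 'I_d * 'I_d) x : bool * bool :=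
  let: (i, j, k) := t in (x i, x (if x i then k else j)).

Definition cut_partition t := preim_partition (cut t) [set: cube d].

Lemma pblock_cut t x :
  pblock (cut_partition t) x =
  face [set t.1.1; if x t.1.1 then t.2 else t.1.2] x.
Proof.
case: t => [[i j] k] /=; apply/setP=> y.
rewrite /cut_partition /preim_partition pblock_equivalence_partition ?inE //.
  rewrite xpair_eqE; apply/andP/forall_inP => [[/eqP xi]|H].
    rewrite -xi => /eqP xj v /set2P[] ->; exact/eqP.
  have /eqP -> := H i (set21 _ _).
  by rewrite eqxx eq_sym; split=> //; apply: H; rewrite set22.
by split=> // /eqP ->.
Qed.

Lemma cut_is_partition t : partition (cut_partition t) [set: cube d].
Proof. exact: preim_partitionP. Qed.

(** For [i != j], both sides consist of the four faces given by the values at [i] and [j]. *)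
Lemma cut_partition_sym i j : cut_partition (i, j, j) = cut_partition (j, i, i).
Proof.
rewrite -[LHS](equivalence_partition_pblock (cut_is_partition _)).
rewrite -[RHS](equivalence_partition_pblock (cut_is_partition _)).
apply: eq_imset => x; apply/setP=> y; rewrite !inE !pblock_cut /=.
by rewrite !if_same setUC.
Qed.

Lemma sens_cut t x :
  sens (cut_partition t) x = [set t.1.1; if x t.1.1 then t.2 else t.1.2].
Proof.
apply/setP=> v; rewrite inE pblock_cut flip_face ?negbK //.
exact/faceP.
Qed.

Lemma cut_partition_face t : cut_partition t \in face_partitions_ge (d - 2) d.
Proof.
rewrite inE cut_is_partition /=; apply/forall_inP=> B BP.
have /and3P[_ trivP n0] := cut_is_partition t.
have [B0|[x xB]] := set_0Vmem B; first by rewrite -B0 BP in n0.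
rewrite -(def_pblock trivP BP xB) pblock_cut; apply/face_dim_geP.
by do 2!eexists; split; last reflexivity; rewrite cards2; case: eqP.
Qed.

Lemma cut_partition_nontrivial t : cut_partition t != [set [set: cube d]].
Proof.
apply/eqP => eqP; pose x : cube d := [ffun=> false].
have : t.1.1 \in sens (cut_partition t) x by rewrite sens_cut set21.
rewrite inE eqP (@def_pblock _ _ [set: cube d]) ?inE //.
by rewrite /trivIset /cover !big_set1.
Qed.

Lemma set2_injr (T : finType) (a b c : T) : [set a; b] = [set a; c] -> b = c.
Proof.
move=> eqS; have := set22 a b; rewrite eqS => /set2P[ba|//].
by have := set22 a c; rewrite -eqS ba => /set2P[].
Qed.

Lemma set2_neq (T : finType) (a b c e : T) :
  [set a; b] = [set c; e] -> a != c -> b = c /\ e = a.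
Proof.
move=> eqS ac; have := set21 a b; rewrite eqS => /set2P[/eqP|->].
  by rewrite (negPf ac).
have := set21 c e; rewrite -eqS => /set2P[/eqP|->] //.
by rewrite eq_sym (negPf ac).
Qed.

Lemma cut_partition_inj i j k i' j' k' :
  cut_partition (i, j, k) = cut_partition (i', j', k') ->
  (i, j, k) = (i', j', k') \/ [/\ i != i', j = i', k = i', j' = i & k' = i].
Proof.
move=> eqP.
have eqS x : [set i; if x i then k else j] = [set i'; if x i' then k' else j'].
  by have := sens_cut (i, j, k) x; rewrite eqP sens_cut.
(* The constant points lie in known halves whatever [i] and [i'] are, which gives
   [{i, j} = {i', j'}] and [{i, k} = {i', k'}]. *)
have := eqS [ffun=> false]; have := eqS [ffun=> true]; rewrite !ffunE.
have [<- /set2_injr-> /set2_injr-> |ii'] := eqVneq i i'; first by left.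
by move=> /set2_neq/(_ ii')[-> ->] /set2_neq/(_ ii')[-> ->]; right.
Qed.

Lemma face_partition_cut P :
  P \in face_partitions_ge (d - 2) d ->
  P != [set [set: cube d]] -> exists t, P = cut_partition t.
Proof.
move=> HP ntP; have partP : partition P [set: cube d].
  by move: HP; rewrite inE => /andP[].
have blockE := equivalence_partition_pblock partP.
have sens_n0 x : sens P x != set0.
  (* A point with no sensitive coordinate has the whole cube as its block. *)
  apply: contraNneq ntP => S0; have [_] := sens_spec HP x.
  rewrite S0 => eqB; have /and3P[/eqP cov triv n0] := partP.
  have BT : pblock P x = [set: cube d].
    by rewrite eqB; apply/setP=> y; rewrite in_setT; apply/faceP=> v; rewrite inE.
  have TP : [set: cube d] \in P by rewrite -BT pblock_mem // cov.
  rewrite eqEsubset sub1set TP andbT; apply/subsetP=> B BP; rewrite inE.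
  have [B0|[y yB]] := set_0Vmem B; first by rewrite -B0 BP in n0.
  by rewrite -(def_pblock triv BP yB) -(def_pblock triv TP (in_setT y)).
have [i iS] := common_sens HP sens_n0.
have [j Sj] := sens_half HP false iS.
have [k Sk] := sens_half HP true iS.
exists (i, j, k).
(* A partition is determined by its block function, so it suffices to compare the blocks of each
   point. *)
rewrite -blockE -[RHS](equivalence_partition_pblock (cut_is_partition _)).
apply: eq_imset => x; apply/setP=> y; rewrite !inE.
have [_ ->] := sens_spec HP x; rewrite pblock_cut /=.
by case: ifP => [/Sk|/Sj] ->.
Qed.

(** * Counting triples up to coincidence *)

Definition normal_triples : {set 'I_d * 'I_d * 'I_d} :=
  [set t : 'I_d * 'I_d * 'I_d | ~~ ((t.1.2 == t.2) && (t.1.1 < t.2))].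

(** Grouping the pairs by their larger entry [j] gives the sum of all [j < d]. *)
Lemma card_ltn_pairs : #|[set p : 'I_d * 'I_d | p.1 < p.2]| = 'C(d, 2).
Proof.
rewrite -bin2_sum big_mkord -sum1_card.
rewrite (eq_bigl (fun p : 'I_d * 'I_d => true && (p.1 < p.2))); last first.
  by move=> p; rewrite inE.
rewrite -(pair_big_dep xpredT (fun i j : 'I_d => i < j) (fun _ _ => 1)) /=.
rewrite (exchange_big_dep xpredT) //=; apply: eq_bigr => j _.
by rewrite -(big_ord_widen d (fun=> 1)) 1?ltnW // sum1_card card_ord.
Qed.

Lemma card_normal_triples : #|normal_triples| + 'C(d, 2) = d ^ 3.
Proof.
rewrite -card_ltn_pairs.
have -> : d ^ 3 = #|{: 'I_d * 'I_d * 'I_d}| by rewrite !card_prod !card_ord; ring.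
rewrite -(cardsC normal_triples); congr (_ + _).
(* The discarded triples are the [(i, j, j)] with [i < j], one for each increasing pair. *)
have inj : injective (fun p : 'I_d * 'I_d => (p.1, p.2, p.2)).
  by move=> [? ?] [? ?] [-> ->].
rewrite -(card_imset _ inj); apply: eq_card => t; rewrite !inE negbK.
apply/imsetP/andP => [[[i j]]|[/eqP]].
  by rewrite inE => lt ->.
by case: t => [[i j] k] /= -> lt; exists (i, k); rewrite ?inE.
Qed.

Lemma face_partitions_codim2 : face_partitions_ge (d - 2) d =
  [set [set: cube d]] |: cut_partition @: normal_triples.
Proof.
apply/setP=> P; rewrite in_setU1; apply/idP/orP => [HP|[/eqP ->|]].
- have [->|ntP] := eqVneq P [set [set: cube d]]; [by left | right].
  have [[[i j] k] ->] := face_partition_cut HP ntP.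
  have [tN|] := boolP ((i, j, k) \in normal_triples); first exact: imset_f.
  rewrite inE negbK /= => /andP[/eqP-> lt].
  (* A discarded [(i, j, j)] is replaced by its normal twin [(j, i, i)]. *)
  rewrite cut_partition_sym; apply: imset_f.
  by rewrite inE /= eqxx /= -leqNgt ltnW.
- rewrite inE; apply/andP; split.
    rewrite /partition /cover /trivIset !big_set1 !eqxx /= /cover big_set1.
    by rewrite eqxx inE eq_sym; apply/set0Pn; exists [ffun=> false].
  apply/forall_inP=> B /set1P ->; apply/face_dim_geP.
  exists set0, [ffun=> false]; rewrite cards0; split=> //.
  by apply/setP=> x; rewrite in_setT; apply/esym/faceP=> v; rewrite inE.
- by case/imsetP=> t _ ->; apply: cut_partition_face.
Qed.

Lemma f_ge_codim2 : f_ge (d - 2) d + 'C(d, 2) = 1 + d ^ 3.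
Proof.
rewrite /f_ge face_partitions_codim2 cardsU1 -card_normal_triples -addnA.
rewrite card_in_imset.
  congr (_ + _); apply/eqP; rewrite eqb1; apply/imsetP=> -[t _ eqt].
  by have := cut_partition_nontrivial t; rewrite -eqt eqxx.
move=> [[i j] k] [[i' j'] k']; rewrite !inE /= => ni ni'.
case/cut_partition_inj => // -[ii' ej ek ej' ek']; subst.
(* Of two distinct twins, only one is normal. *)
by move: ii' ni ni'; rewrite !eqxx /= -!leqNgt -val_eqE /=; lia.
Qed.

End Faces.

Import GRing.Theory.
Local Open Scope ring_scope.

(* [d - 2] is truncated subtraction: for [d = 1] it is 0 instead of -1, which
   imposes the same (void) condition on the dimensions. *)
Theorem corollary1 (d : nat) (hd : (1 <= d)%N) :
  (f_ge (d - 2)%N d)%:Z = 1 - ('C(d, 2))%:Z + d%:Z ^+ 3.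
Proof.
by have := f_ge_codim2 d; lia.
Qed.
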